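(* Let $n\ge1$ and let $\Phi\in\mathcal{Y}$ be a Young's function. (i) There exists a constant $\mathscr{C}=\mathscr{C}(n,\Phi)>0$ such that for all $\varphi\in L^{\Phi}$ and $t>0$, $$\|S(t)\varphi\|_{\infty}\le \mathscr{C}\,\Phi^{-1}\left(t^{-n/2}\right)\|\varphi\|_{\Phi}.$$ (ii) If $\Phi$ is finite then $$\lim_{t\to0}\frac{\|S(t)\varphi\|_{\infty}}{\Phi^{-1}\left(t^{-n/2}\right)}=0,$$ uniformly for $\varphi$ in compact subsets of $L_0^{\Phi}$.
   Context: ''Increasing'' means nondecreasing. A (nontrivial) Young's function is a map $\Phi:[0,\infty]\to[0,\infty]$ with $\Phi(0)=0$ such that either (I) $\Phi$ is convex, increasing, finite-valued and not identically zero on $[0,\infty)$; or (II) there is $x_\infty^{\Phi}>0$ such that $\Phi$ is convex, increasing and finite-valued on $[0,x_\infty^{\Phi}]$ and $\Phi(x)=\infty$ for $x>x_\infty^{\Phi}$; or (III) there is $x_\infty^{\Phi}>0$ such that $\Phi$ is convex, increasing and finite-valued on $[0,x_\infty^{\Phi})$, $\lim_{x\uparrow x_\infty^{\Phi}}\Phi(x)=\infty$ and $\Phi(x)=\infty$ for $x\ge x_\infty^{\Phi}$. The set of Young's functions is $\mathcal{Y}$. $\Phi\in\mathcal{Y}$ is finite if it satisfies (I). The generalised inverse is $\Phi^{-1}(y)=\inf\{x>0:\Phi(x)>y\}$, with $\inf\emptyset=\infty$. All function spaces are over $\mathbb{R}^n$ and consist of Lebesgue measurable real-valued functions (identified when equal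 a.e.); $\|\cdot\|_\infty$ is the $L^\infty(\mathbb{R}^n)$ norm. $L^{\Phi}$ is the set of measurable $u$ with $\int_{\mathbb{R}^n}\Phi(|u(x)|/k)\,dx<\infty$ for some $k>0$, with the Luxemburg norm $\|u\|_{\Phi}=\inf\{k>0:\int_{\mathbb{R}^n}\Phi(|u(x)|/k)\,dx\le1\}$. $L_0^{\Phi}$ is the closure of $C_0^\infty(\mathbb{R}^n)$ (smooth compactly supported functions) in $L^{\Phi}$. $S(t)$ is the heat semigroup: $[S(t)\varphi](x)=\int_{\mathbb{R}^n}G(x-y,t)\varphi(y)\,dy$ for $t>0$, where $G(x,t)=(4\pi t)^{-n/2}\exp(-|x|^2/(4t))$. *)

(* Defs.v *)
From HB Require Import structures.
From mathcomp Require Import all_boot all_order all_algebra.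
From mathcomp Require Import all_classical all_reals all_analysis.

Set Implicit Arguments.
Unset Strict Implicit.
Unset Printing Implicit Defensive.
Import Order.TTheory GRing.Theory Num.Theory.
Import numFieldNormedType.Exports.

Local Open Scope classical_set_scope.
Local Open Scope ring_scope.

(** MathComp-Analysis only has Lebesgue measure on R.  The product
   sigma-algebra on ['rV[T]_n] is defined as the library does for
   [n.-tuple T]; the Lebesgue measure on the Borel sets is the iterated product
   of the one-dimensional one, and it is then completed. *)

Section measurable_rV.
Context {d : measure_display} {T : measurableType d}.
Variable n : nat.

Let coord : 'I_n -> 'rV[T]_n -> T := fun i x => x ord0 i.

Let rV_set0 : g_sigma_preimage coord set0.
Proof. exact: sigma_algebra0. Qed.

Let rV_setC A : g_sigma_preimage coord A -> g_sigma_preimage coord (~` A).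
Proof. exact: sigma_algebraC. Qed.

Let rV_bigcup (F : (set _)^nat) : (forall i, g_sigma_preimage coord (F i)) ->
  g_sigma_preimage coord (\bigcup_i (F i)).
Proof. exact: sigma_algebra_bigcup. Qed.

HB.instance Definition _ := @isMeasurable.Build (measure_tuple_display d)
  'rV[T]_n (g_sigma_preimage coord) rV_set0 rV_setC rV_bigcup.

Lemma measurable_coord (i : 'I_n) :
  measurable_fun [set: 'rV[T]_n] (fun x : 'rV[T]_n => x ord0 i).
Proof.
move=> _ Y mY; rewrite setTI; apply: sub_sigma_algebra => /=.
rewrite -bigcup_seq/=; exists i => /=; first by rewrite mem_index_enum.
by exists Y => //; rewrite setTI.
Qed.

Lemma measurable_fun_coordP {d1} {T1 : measurableType d1} (f : T1 -> 'rV[T]_n) :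
  (forall i, measurable_fun [set: T1] (fun x => f x ord0 i)) ->
  measurable_fun [set: T1] f.
Proof.
move=> mf.
suff prefS : g_sigma_preimage (fun i => coord i \o f) `<=` measurable.
  move=> _ A mA; apply: prefS; rewrite g_sigma_preimage_comp.
  by exists A.
apply: smallest_sub; first exact: sigma_algebra_measurable.
rewrite -bigcup_seq; apply: bigcup_sub => i _.
by move=> A [B mB <-]; exact: mf.
Qed.

End measurable_rV.

Section lebesgue_rV.
Variable R : realType.

Definition rV_cons n (p : R * 'rV[R]_n) : 'rV[R]_n.+1 :=
  \row_i oapp (fun j => p.2 ord0 j) p.1 (unlift ord0 i).

Let rV_uncons n (x : 'rV[R]_n.+1) : R * 'rV[R]_n :=
  (x ord0 ord0, \row_i x ord0 (lift ord0 i)).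

Lemma rV_consE0 n (p : R * 'rV[R]_n) : rV_cons p ord0 ord0 = p.1.
Proof. by rewrite mxE unlift_none. Qed.

Lemma rV_consES n (p : R * 'rV[R]_n) i :
  rV_cons p ord0 (lift ord0 i) = p.2 ord0 i.
Proof. by rewrite mxE liftK. Qed.

Let rV_consK n : cancel (@rV_cons n) (@rV_uncons n).
Proof.
move=> [a x]; rewrite /rV_uncons rV_consE0; congr pair.
by apply/rowP => i; rewrite mxE rV_consES.
Qed.

Lemma measurable_rV_cons n : measurable_fun setT (@rV_cons n).
Proof.
apply: measurable_fun_coordP => i.
case: (unliftP ord0 i) => [j ->|->].
- under eq_fun do rewrite rV_consES.
  by apply: (measurableT_comp (measurable_coord j)); exact: measurable_snd.
- by under eq_fun do rewrite rV_consE0; exact: measurable_fst.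
Qed.

Hint Extern 0 (measurable_fun _ (@rV_cons _)) =>
  exact: measurable_rV_cons : core.

Let measurable_rV_uncons n : measurable_fun setT (@rV_uncons n).
Proof.
apply: measurable_fun_pair; first exact: measurable_coord.
apply: measurable_fun_coordP => i.
by under eq_fun do rewrite mxE; exact: measurable_coord.
Qed.

Section lebesgue_cons.
Variables (n : nat) (mu : {sigma_finite_measure set 'rV[R]_n -> \bar R}).

Definition lebesgue_cons : set 'rV[R]_n.+1 -> \bar R :=
  pushforward (@lebesgue_measure R \x mu)%E (@rV_cons n).

Let lebesgue_cons0 : lebesgue_cons set0 = 0%E.
Proof. exact: measure0. Qed.

Let lebesgue_cons_ge0 A : (0 <= lebesgue_cons A)%E.
Proof. exact: measure_ge0. Qed.

Let lebesgue_cons_sigma_additive : semi_sigma_additive lebesgue_cons.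
Proof. exact: measure_semi_sigma_additive. Qed.

HB.instance Definition _ := isMeasure.Build _ _ _ lebesgue_cons
  lebesgue_cons0 lebesgue_cons_ge0 lebesgue_cons_sigma_additive.

Let lebesgue_cons_sigma_finite : sigma_finite setT lebesgue_cons.
Proof.
have /sigma_finiteP[F [UF ndF Foo]] := sigma_finiteT (@lebesgue_measure R).
have /sigma_finiteP[G [UG ndG Goo]] := sigma_finiteT mu.
exists (fun k => @rV_uncons n @^-1` (F k `*` G k)).
  rewrite -preimage_bigcup (_ : \bigcup_k _ = setT) ?preimage_setT//.
  apply/seteqP; split => // -[x y] _.
  have [k _ Fkx] : (\bigcup_i F i) x by rewrite -UF.
  have [l _ Gly] : (\bigcup_i G i) y by rewrite -UG.
  exists (maxn k l) => //; split => /=.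
    by move: x Fkx; exact/subsetPset/ndF/leq_maxl.
  by move: y Gly; exact/subsetPset/ndG/leq_maxr.
move=> k; have [mFk Fk_fin] := Foo k; have [mGk Gk_fin] := Goo k; split.
  rewrite -[X in measurable X]setTI.
  by apply: measurable_rV_uncons => //; exact: measurableX.
rewrite /lebesgue_cons /pushforward -comp_preimage.
rewrite (_ : _ \o _ = id) ?preimage_id; last first.
  by apply/funext => p; exact: rV_consK.
by rewrite product_measure1E// lte_mul_pinfty// ge0_fin_numE.
Qed.

HB.instance Definition _ := Measure_isSigmaFinite.Build _ _ _ lebesgue_cons
  lebesgue_cons_sigma_finite.

End lebesgue_cons.

Fixpoint borel_lebesgue n : {sigma_finite_measure set 'rV[R]_n -> \bar R} :=
  match n with
  | 0 => \d_(0 : 'rV[R]_0)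
  | k.+1 => lebesgue_cons (borel_lebesgue k)
  end.

(** ['rV[R]_n] with the Lebesgue measurable sets (rather than the Borel ones)
   as its sigma-algebra. *)
Definition Rn n := caratheodory_type (borel_lebesgue n)^*%mu.

HB.instance Definition _ n := Measurable.on (Rn n).

Definition lebesgue_Rn n : set (Rn n) -> \bar R :=
  @completed_measure_extension _ _ _ (borel_lebesgue n).

HB.instance Definition _ n := Measure.on (@lebesgue_Rn n).

End lebesgue_rV.

Section young.
Variable R : realType.
Implicit Types (Phi : \bar R -> \bar R) (D : set R).

Definition convex_increasing_on D Phi :=
  [/\ {in D, forall x, Phi x%:E \is a fin_num},
      {in D &, {homo (fun x => fine (Phi x%:E)) : x y / x <= y}} &
      convex_function D (fun x : R => fine (Phi x%:E))].

(** The three kinds of Young's functions: finite-valued; jumping to +oo after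
   a point [a] where they are still finite; blowing up at [a]. *)
Definition young_finite Phi :=
  convex_increasing_on `[0, +oo[ Phi /\ exists2 x, 0 <= x & Phi x%:E != 0%E.

Definition young_jump Phi := exists a : R,
  [/\ 0 < a, convex_increasing_on `[0, a] Phi &
      forall x, (a%:E < x)%E -> Phi x = +oo%E].

Definition young_blowup Phi := exists a : R,
  [/\ 0 < a, convex_increasing_on `[0, a[ Phi,
      Phi x%:E @[x --> a^'-] --> +oo%E &
      forall x, (a%:E <= x)%E -> Phi x = +oo%E].

(** A map from [0, +oo] to itself is encoded as a map on \bar R whose values at
   negative arguments are irrelevant. *)
Definition young Phi :=
  [/\ forall x, (0 <= x -> 0 <= Phi x)%E, Phi 0%E = 0%E &
      young_finite Phi \/ young_jump Phi \/ young_blowup Phi].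

Definition young_inv Phi (y : \bar R) : \bar R :=
  ereal_inf [set x | 0 < x /\ y < Phi x]%E.

End young.

Section orlicz.
Variables (R : realType) (n : nat).
Implicit Types (Phi : \bar R -> \bar R) (u : Rn R n -> R).

Definition modular Phi u (k : R) : \bar R :=
  (\int[@lebesgue_Rn R n]_x Phi (`|u x| / k)%:E)%E.

Definition luxemburg Phi u : \bar R :=
  ereal_inf [set k%:E | k in [set k : R | 0 < k /\ (modular Phi u k <= 1)%E]].

(** Elements of [orlicz Phi] are functions rather than classes modulo a.e.
   equality; [luxemburg Phi] is a seminorm on them. *)
Record orlicz Phi := Orlicz {
  orlicz_fun :> Rn R n -> R ;
  orlicz_measurable : measurable_fun [set: Rn R n] orlicz_fun ;
  orlicz_integrable :
    exists2 k : R, 0 < k & (modular Phi orlicz_fun k < +oo)%E }.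

HB.instance Definition _ Phi := gen_eqMixin (orlicz Phi).
HB.instance Definition _ Phi := gen_choiceMixin (orlicz Phi).

Definition orlicz_ball Phi (u : orlicz Phi) (r : R) : set (orlicz Phi) :=
  [set v | (luxemburg Phi (fun x => (u x - v x)%R) < r%:E)%E].

(** The norm topology of [orlicz Phi].  For a Young's function [Phi] the balls
   form a base, by the triangle inequality; declaring them as a subbase
   gives the same topology.  A set of functions is compact for it iff the
   corresponding set of classes is compact in the quotient. *)
HB.instance Definition _ Phi := isSubBaseTopological.Build (orlicz Phi)
  [set B : set (orlicz Phi) |
    exists (u : orlicz Phi) (r : R), 0 < r /\ B = orlicz_ball u r] id.

Fixpoint continuously_differentiable (k : nat) (f : 'rV[R]_n -> R) : Prop :=
  if k is j.+1 then
    forall i : 'I_n, (forall x, derivable f x (delta_mx ord0 i)) /\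
      continuously_differentiable j (fun x => 'D_(delta_mx ord0 i) f x)
  else continuous f.

Definition test_function (f : 'rV[R]_n -> R) :=
  (forall k, continuously_differentiable k f) /\
  compact (closure [set x | f x != 0]).

Definition orlicz0 Phi : set (orlicz Phi) :=
  closure [set u : orlicz Phi | test_function u].

Definition gauss_kernel (x : 'rV[R]_n) (t : R) : R :=
  (4 * pi * t) `^ (- (n%:R / 2)) *
  expR (- ((\sum_i x ord0 i ^+ 2) / (4 * t))).

(** An extended-real integral, so that the value is infinite, and not a default
   real, wherever the convolution does not converge absolutely. *)
Definition heat (t : R) (phi : Rn R n -> R) (x : Rn R n) : \bar R :=
  (\int[@lebesgue_Rn R n]_y
     (gauss_kernel ((x : 'rV[R]_n) - (y : 'rV[R]_n)) t * phi y)%:E)%E.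

End orlicz.

(* Main.v *)
Require Import Defs.
From mathcomp Require Import all_boot all_order all_algebra.
From mathcomp Require Import all_classical all_reals all_analysis.
From mathcomp Require Import measurable_realfun ess_sup_inf ring lra.

Import Order.TTheory GRing.Theory Num.Theory.
Import numFieldNormedType.Exports.
Local Open Scope classical_set_scope.
Local Open Scope ring_scope.

Set Implicit Arguments.
Unset Strict Implicit.
Unset Printing Implicit Defensive.

(** On the half-line, a Young's function is nondecreasing ([young_le]) and
   star-shaped: [Phi (l * s) <= l * Phi s] for [0 <= l <= 1] ([young_scale]).
   If [y < Phi c], this gives the affine bound [s <= c + (c / y) * Phi s] for
   all [s >= 0] ([young_linear_bound]): when [s > c], take [l = c / s].

   Take [y = t^(-n/2)], which bounds the Gauss kernel [G].  Applying the bound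
   to [s = |u| / k], where the modular of [u] at [k] is at most 1, and
   integrating against [G], whose total mass is 1, gives
   [int G |u| <= k c (1 + 1)].  Letting [c] decrease to the generalised inverse
   at [y], then [k] to the Luxemburg norm of [u], proves the first part with
   constant 2 ([average_le_young_inv], [heat_norm_le]).

   The second part is an approximation argument.  A bounded function has a heat
   extension bounded by the same constant, whereas the generalised inverse at
   [t^(-n/2)] tends to infinity as [t] tends to 0 when [Phi] is finite
   ([young_inv_cvgy]).  Near a point [chi] of the compact set, choose a test
   function [psi] close to [chi] and write
   [phi = (phi - chi) + (chi - psi) + psi]: the first two terms are small by the
   first part, uniformly in [t], and the third is negligible for small [t].  So
   the estimate holds locally uniformly in [phi], and compactness, in its
   near-covering form, makes it uniform ([heat_norm_small_near0]). *)

(** * The Gauss kernel has total mass 1 *)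

Section gaussian.
Context {R : realType}.

Lemma measurable_Rn_rV n :
  measurable_fun [set: Rn R n] (fun x : Rn R n => (x : 'rV[R]_n)).
Proof.
by move=> _ A mA; rewrite setTI; apply: sub_caratheodory; exact: sub_sigma_algebra.
Qed.

Lemma ge0_integral_measure_preserving d1 d2 (X : measurableType d1)
    (Y : measurableType d2) (m1 : {measure set X -> \bar R})
    (m2 : {measure set Y -> \bar R}) (g : X -> Y) :
  measurable_fun [set: X] g ->
  (forall A, measurable A -> m1 (g @^-1` A) = m2 A) ->
  forall f : Y -> \bar R, measurable_fun [set: Y] f ->
  (forall y, 0 <= f y)%E -> (\int[m1]_x f (g x) = \int[m2]_y f y)%E.
Proof.
move=> mg m12 f mf f0; rewrite -(eq_measure_integral m2 (m1 := pushforward m1 g)).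
  by rewrite [RHS](ge0_integral_pushforward mg)// preimage_setT.
by move=> A mA _; exact: m12.
Qed.

Lemma lebesgue_RnE n (A : set 'rV[R]_n) :
  measurable A -> lebesgue_Rn A = borel_lebesgue R n A.
Proof.
move=> mA.
by rewrite /lebesgue_Rn /completed_measure_extension measurable_mu_extE.
Qed.

(** The identity map from the completed space to the Borel one preserves the
   measure of Borel sets. *)
Lemma ge0_integral_lebesgue_Rn n (f : 'rV[R]_n -> \bar R) :
  measurable_fun [set: 'rV[R]_n] f -> (forall x, 0 <= f x)%E ->
  (\int[@lebesgue_Rn R n]_x f x = \int[@borel_lebesgue R n]_x f x)%E.
Proof.
move=> mf f0.
exact: (ge0_integral_measure_preserving (@measurable_Rn_rV n)
  (@lebesgue_RnE n) mf f0).
Qed.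

Lemma measurable_gauss_kernel n (x : 'rV[R]_n) t :
  measurable_fun setT (fun y : 'rV[R]_n => gauss_kernel (x - y) t).
Proof.
rewrite /gauss_kernel; apply: measurable_funM => //.
apply: measurableT_comp => //; apply: measurableT_comp => //.
apply: measurable_funM => //; apply: measurable_sum => i.
apply: measurable_funX; under eq_fun do rewrite !mxE.
apply: measurable_funB => //; exact: measurable_coord.
Qed.

(** The integrand is the normal density of mean [a] and variance [2 * t]. *)
Lemma integral_gauss1 (a t : R) : 0 < t ->
  (\int[@lebesgue_measure R]_s
    ((4 * pi * t) `^ (- 2^-1) * expR (- ((a - s) ^+ 2 / (4 * t))))%:E = 1)%E.
Proof.
move=> t0; have s0 : Num.sqrt (2 * t) != 0.
  by rewrite gt_eqF// sqrtr_gt0 mulr_gt0.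
rewrite -(integral_normal_pdf a (Num.sqrt (2 * t))).
apply: eq_integral => s _; rewrite normal_pdfE//= /normal_peak /normal_fun.
rewrite sqr_sqrtr ?mulr_ge0 ?ltW// powRN powR12_sqrt//; last first.
  by rewrite !mulr_ge0// ?pi_ge0// ltW.
congr (((Num.sqrt _)^-1 * expR _)%:E).
  by rewrite -mulr_natr; ring.
have -> : 2 * t *+ 2 = 4 * t by rewrite -mulr_natr; ring.
by rewrite mulNr -[a - s]opprB sqrrN.
Qed.

(** The Gaussian is a product over coordinates; splitting off the first one
   matches the iterated construction of Lebesgue measure. *)
Lemma gauss_kernelS n (a : R) (v x : _) (t : R) : 0 < t ->
  gauss_kernel (x - rV_cons (a, v) : 'rV[R]_n.+1) t =
  ((4 * pi * t) `^ (- 2^-1) * expR (- ((x ord0 ord0 - a) ^+ 2 / (4 * t)))) *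
  gauss_kernel ((\row_i x ord0 (lift ord0 i)) - v : 'rV[R]_n) t.
Proof.
move=> t0; rewrite /gauss_kernel big_ord_recl !mxE unlift_none/=.
under eq_bigr do rewrite !mxE liftK/=.
under [in RHS]eq_bigr do rewrite !mxE.
set p := x ord0 ord0 - a; set q := \sum_(_ < _) _.
rewrite [(_ + q) / _]mulrDl opprD expRD.
rewrite (_ : - (n.+1%:R / 2) = - 2^-1 + - (n%:R / 2)); last first.
  by rewrite -natr1; lra.
rewrite powRD; last first.
  by apply/implyP => _; rewrite !mulf_neq0// ?gt_eqF// pi_gt0.
ring.
Qed.

Lemma gauss_kernel_ge0 n (x : 'rV[R]_n) t : 0 <= gauss_kernel x t.
Proof. by rewrite mulr_ge0 ?powR_ge0 ?expR_ge0. Qed.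

(** Tonelli's theorem and induction on the dimension. *)
Lemma integral_borel_gauss n (x : 'rV[R]_n) (t : R) : 0 < t ->
  (\int[@borel_lebesgue R n]_y (gauss_kernel (x - y) t)%:E = 1)%E.
Proof.
move=> t0.
have mg m (z : 'rV[R]_m) :
    measurable_fun setT (fun y : 'rV[R]_m => (gauss_kernel (z - y) t)%:E).
  by apply/measurable_EFinP; exact: measurable_gauss_kernel.
elim: n x => [|n IH] x.
  rewrite integral_dirac//; last exact: mg.
  by rewrite diracT mul1e /gauss_kernel big_ord0 !mul0r !oppr0 powRr0 expR0 mulr1.
rewrite ge0_integral_pushforward//=; [|exact: measurable_rV_cons|exact: mg|];
  last first.
  by move=> y _; rewrite lee_fin gauss_kernel_ge0.
rewrite preimage_setT fubini_tonelli1//; last 2 first.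
- apply: (measurableT_comp (mg _ x)); exact: measurable_rV_cons.
- by move=> y; rewrite lee_fin gauss_kernel_ge0.
rewrite -(integral_gauss1 (x ord0 ord0) t0); apply: eq_integral => a _.
rewrite /fubini_F/=.
under eq_integral => v _ do rewrite gauss_kernelS// EFinM.
rewrite ge0_integralZl//.
- by rewrite IH mule1.
- exact: mg.
- by move=> v _; rewrite lee_fin gauss_kernel_ge0.
- by rewrite lee_fin mulr_ge0 ?powR_ge0 ?expR_ge0.
Qed.

Lemma integral_gauss_kernel n (x : 'rV[R]_n) (t : R) : 0 < t ->
  (\int[@lebesgue_Rn R n]_y (gauss_kernel (x - (y : 'rV[R]_n)) t)%:E = 1)%E.
Proof.
move=> t0.
rewrite (@ge0_integral_lebesgue_Rn n (fun y : 'rV[R]_n => (gauss_kernel (x - y) t)%:E)).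
- exact: integral_borel_gauss.
- by apply/measurable_EFinP; exact: measurable_gauss_kernel.
- by move=> y; rewrite lee_fin mulr_ge0 ?powR_ge0 ?expR_ge0.
Qed.

Lemma gauss_kernel_le n (x : 'rV[R]_n) (t : R) : 0 < t ->
  gauss_kernel x t <= t `^ (- (n%:R / 2)).
Proof.
move=> t0; rewrite /gauss_kernel -[leRHS]mulr1 ler_pM ?powR_ge0 ?expR_ge0//.
  rewrite !powRN lef_pV2 ?posrE ?powR_gt0 ?mulr_gt0 ?pi_gt0//.
  have ct : t <= 4 * pi * t.
    by rewrite ler_peMl ?ltW//; have := pi_ge2 R; lra.
  apply: ge0_ler_powR => //; rewrite nnegrE; first exact: ltW.
  exact: le_trans (ltW t0) ct.
rewrite -expR0 ler_expR oppr_le0 mulr_ge0 ?invr_ge0 ?sumr_ge0//.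
  by move=> i _; exact: sqr_ge0.
by rewrite mulr_ge0 ?ltW.
Qed.

End gaussian.

(** * Young's functions *)

Section young_functions.
Context {R : realType}.
Implicit Type Phi : \bar R -> \bar R.

(** A common description of the three kinds of Young's functions: [D] is the
   part of the half-line where [Phi] is finite. *)
Lemma young_domain Phi : young Phi -> exists D : set R,
  [/\ convex_increasing_on D Phi,
      D 0 /\ (forall r s : R, 0 <= r <= s -> D s -> D r),
      exists2 x : R, 0 < x & D x,
      exists2 x : R, 0 < x & Phi x%:E != 0%E &
      forall s : R, 0 <= s -> ~ D s -> Phi s%:E = +oo%E].
Proof.
move=> [_ Phi0 [|[]]].
- move=> [PhiI [x x0 Phix]]; exists [set` `[0, +oo[]; split => //=.
  + by split=> [|r s /andP[r0 rs]]; rewrite !in_itv/= ?lexx// !andbT.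
  + by exists 1 => //; rewrite in_itv/= ler01.
  + exists x => //; rewrite lt_neqAle x0 andbT.
    by apply: contra_neq Phix => <-.
  + by move=> s s0; rewrite in_itv/= s0.
- move=> [a [a0 PhiI Phioo]]; exists [set` `[0, a]]; split => //=.
  + split=> [|r s /andP[r0 rs]]; first by rewrite in_itv/= lexx ltW.
    by rewrite !in_itv/= r0 => /andP[_]; exact: le_trans.
  + by exists a => //; rewrite in_itv/= lexx ltW.
  + by exists (a + 1); rewrite ?addr_gt0// Phioo// lte_fin ltrDl.
  + move=> s s0; rewrite in_itv/= s0/= => /negP; rewrite -ltNge => sa.
    by rewrite Phioo.
- move=> [a [a0 PhiI _ Phioo]]; exists [set` `[0, a[]; split => //=.
  + split=> [|r s /andP[r0 rs]]; first by rewrite in_itv/= lexx.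
    by rewrite !in_itv/= r0 => /andP[_]; exact: le_lt_trans.
  + by exists (a / 2); rewrite ?divr_gt0// in_itv/=; apply/andP; split; lra.
  + by exists a => //; rewrite Phioo.
  + move=> s s0; rewrite in_itv/= s0/= => /negP; rewrite -leNgt => sa.
    by rewrite Phioo.
Qed.

Lemma young_ge0 Phi (s : R) : young Phi -> 0 <= s -> (0 <= Phi s%:E)%E.
Proof. by move=> [Phi_ge0 _ _] s0; exact: Phi_ge0. Qed.

Lemma young_le Phi (r s : R) : young Phi -> 0 <= r -> r <= s ->
  (Phi r%:E <= Phi s%:E)%E.
Proof.
move=> PhiY r0 rs; have [D [[Dfin Dle _] [_ Ddown] _ _ Doo]] := young_domain PhiY.
have [Ds|nDs] := pselect (D s); last by rewrite (Doo s) ?leey// (le_trans r0).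
have Dr : D r by apply: Ddown Ds; rewrite r0.
rewrite -(fineK (Dfin r _)) ?inE// -(fineK (Dfin s _)) ?inE// lee_fin.
by apply: Dle; rewrite ?inE.
Qed.

(** On the finiteness domain this is convexity between [s] and 0; elsewhere the
   right-hand side is infinite unless [l = 0]. *)
Lemma young_scale Phi (l s : R) : young Phi -> 0 <= l -> l <= 1 -> 0 <= s ->
  (Phi (l * s)%:E <= l%:E * Phi s%:E)%E.
Proof.
move=> PhiY l0 l1 s0.
have [D [[Dfin Dle Dcvx] [D0 Ddown] _ _ Doo]] := young_domain PhiY.
have Phi0 : Phi 0%:E = 0%E by case: PhiY.
have [Ds|nDs] := pselect (D s); last first.
  rewrite (Doo s)//; move: l0; rewrite le_eqVlt => /predU1P[<-|l0].
    by rewrite mul0r mul0e Phi0.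
  by rewrite gt0_muley ?leey.
have Dr : D (l * s) by apply: Ddown Ds; rewrite mulr_ge0//= ler_piMl.
rewrite -(fineK (Dfin (l * s) _)) ?inE// -(fineK (Dfin s _)) ?inE//.
rewrite -EFinM lee_fin.
have := Dcvx (Itv01 l0 l1) s 0; rewrite !inE => /(_ Ds D0).
have -> : conv (Itv01 l0 l1) (s : convex_lmodType R^o) 0 = l * s + (1 - l) * 0 by [].
rewrite convRE/=.
by rewrite mulr0 Phi0/= mulr0 !addr0.
Qed.

(** If [Phi x] is finite and positive, star-shapedness makes [Phi] grow at least
   linearly along the multiples of [x]. *)
Lemma young_unbounded Phi (y : R) : young Phi ->
  exists2 c : R, 0 < c & (y%:E < Phi c%:E)%E.
Proof.
move=> PhiY; have [D [_ _ _ [x x0 Phix] _]] := young_domain PhiY.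
have : (0 < Phi x%:E)%E by rewrite lt_neqAle eq_sym Phix young_ge0// ltW.
case Ep : (Phi x%:E) => [p| |]//; last first.
  by move=> _; exists x => //; rewrite Ep ltry.
rewrite lte_fin => p0; pose m := `|y| / p + 1.
have m1 : 1 <= m by rewrite /m lerDr divr_ge0// ltW.
have m0 : 0 < m by exact: lt_le_trans m1.
(* [Phi x <= m^-1 * Phi (m * x)], and [m] was chosen so that [m * p > y] *)
exists (m * x); first exact: mulr_gt0.
have := @young_scale Phi m^-1 (m * x) PhiY; rewrite invr_ge0 invf_le1// m1.
rewrite mulKf ?gt_eqF// Ep (ltW m0) => /(_ isT isT (mulr_ge0 (ltW m0) (ltW x0))).
rewrite lee_pdivlMl// -EFinM; apply: lt_le_trans; rewrite lte_fin.
by rewrite (le_lt_trans (ler_norm y))// /m mulrDl mul1r divfK ?gt_eqF// ltrDl.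
Qed.

Lemma measurable_young Phi : young Phi ->
  measurable_fun [set: R] (fun s => Phi `|s|%:E).
Proof.
move=> PhiY; rewrite (_ : (fun _ => _) =
  (fun s => Phi (Num.max s 0)%:E) \o Num.norm); last first.
  by apply/funext => s /=; rewrite max_l.
apply: measurableT_comp => //.
apply: (measurability _ (ErealGenCInfty.measurableE R)) => _ [_ [r ->] <-].
rewrite setTI; apply: is_interval_measurable => s u /=.
rewrite !in_itv/= !andbT => rs _ v /andP[sv _].
rewrite in_itv/= andbT (le_trans rs)//; apply: young_le => //.
  by rewrite le_max lexx orbT.
by rewrite ge_max !le_max lexx sv orbT.
Qed.

(** Star-shapedness replaces a supporting line of [Phi] by this affine bound,
   whose constant [c] can be as close as desired to the generalised inverse. *)
Lemma young_linear_bound Phi (c y s : R) : young Phi -> 0 < c -> 0 < y ->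
  (y%:E < Phi c%:E)%E -> 0 <= s ->
  (s%:E <= c%:E + (c / y)%:E * Phi s%:E)%E.
Proof.
move=> PhiY c0 y0 yc s0.
have cy0 : 0 <= c / y by rewrite divr_ge0 ?ltW.
have [sc|cs] := leP s c.
  by rewrite -[leLHS]adde0 leeD ?lee_fin// mule_ge0 ?lee_fin ?young_ge0.
have sgt0 : 0 < s by exact: lt_trans cs.
have cs0 : 0 <= c / s by rewrite divr_ge0// ltW.
have cs1 : c / s <= 1 by rewrite ler_pdivrMr// mul1r ltW.
have := young_scale PhiY cs0 cs1 s0; rewrite divfK ?gt_eqF// => /(lt_le_trans yc).
have := young_ge0 PhiY s0; case: (Phi s%:E) => [p p0| _|//]; last first.
  by move=> _; rewrite [X in (_ + X)%E]gt0_muley ?addey ?leey// lte_fin divr_gt0.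
rewrite -!EFinM -EFinD lte_fin lee_fin => h.
rewrite -[leLHS]add0r lerD//; first exact: ltW.
move: h; rewrite mulrAC ltr_pdivlMr// => h.
by rewrite mulrAC ler_pdivlMr// mulrC ltW.
Qed.

(** Finiteness comes from unboundedness of [Phi], positivity from its continuity
   at 0, a consequence of star-shapedness. *)
Lemma young_inv_fin_num_gt0 Phi (y : R) : young Phi -> 0 < y ->
  young_inv Phi y%:E \is a fin_num /\ (0 < young_inv Phi y%:E)%E.
Proof.
move=> PhiY y0.
have [c c0 yc] := young_unbounded y PhiY.
have [D [[Dfin _ _] _ [x x0 Dx] _ _]] := young_domain PhiY.
suff [d d0 dle] : exists2 d, 0 < d & (d%:E <= young_inv Phi y%:E)%E.
  have inv0 : (0 < young_inv Phi y%:E)%E by apply: lt_le_trans dle.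
  split=> //; rewrite ge0_fin_numE ?ltW//.
  apply: (@le_lt_trans _ _ c%:E); last exact: ltry.
  by apply: ereal_inf_lbound; rewrite /= lte_fin.
pose f := fine (Phi x%:E).
have fE : Phi x%:E = f%:E by rewrite fineK// Dfin ?inE.
have f0 : 0 <= f by rewrite -lee_fin -fE young_ge0// ltW.
have fy : 0 < f + y by rewrite ltr_wpDl.
(* chosen so that [l <= 1] and [l * Phi x <= y] *)
pose l := y / (f + y); have l0 : 0 < l by rewrite divr_gt0.
exists (l * x); first exact: mulr_gt0.
apply/ereal_infP => z /= [z0 yz]; rewrite leNgt; apply/negP => zlx.
move: z z0 yz zlx => [z| |]//; rewrite !lte_fin => z0 yz zlx.
move: yz; apply/negP; rewrite -leNgt.
apply: (le_trans (young_le PhiY (ltW z0) (ltW zlx))).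
have l1 : l <= 1 by rewrite ler_pdivrMr// mul1r lerDr.
apply: (le_trans (young_scale PhiY (ltW l0) l1 (ltW x0))).
by rewrite fE -EFinM lee_fin /l mulrAC ler_pdivrMr// ler_pM2l// lerDl ltW.
Qed.

Lemma young_inv_ge Phi (B y : R) : young Phi -> 0 <= B ->
  (Phi B%:E <= y%:E)%E -> (B%:E <= young_inv Phi y%:E)%E.
Proof.
move=> PhiY B0 By; apply/ereal_infP => z /= [z0 yz]; rewrite leNgt; apply/negP => zB.
move: z z0 yz zB => [z| |]//; rewrite !lte_fin => z0 yz zB.
move: yz; apply/negP; rewrite -leNgt (le_trans _ By)//.
by apply: young_le => //; exact: ltW.
Qed.

End young_functions.

(** * Averages against a bounded probability density *)

Section averages.
Context {R : realType} d (X : measurableType d) (mu : {measure set X -> \bar R}).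
Variable G : X -> R.
Hypotheses (mG : measurable_fun [set: X] G) (G0 : forall x, 0 <= G x)
  (G1 : (\int[mu]_x (G x)%:E = 1)%E).
Implicit Types (Phi : \bar R -> \bar R) (u v w : X -> R).

Definition average u : \bar R := (\int[mu]_x (G x * `|u x|)%:E)%E.

Let measurable_Gu u : measurable_fun [set: X] u ->
  measurable_fun [set: X] (fun x => (G x * `|u x|)%:E).
Proof.
move=> meas_u; apply/measurable_EFinP; apply: measurable_funM => //.
exact: measurableT_comp.
Qed.

Let Gu_ge0 u x : (0 <= (G x * `|u x|)%:E)%E.
Proof. by rewrite lee_fin mulr_ge0. Qed.

Lemma abs_integral_le_average u : measurable_fun [set: X] u ->
  (`|\int[mu]_x (G x * u x)%:E| <= average u)%E.
Proof.
move=> meas_u; apply: le_trans (le_abse_integral _ measurableT _) _.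
  by apply/measurable_EFinP; exact: measurable_funM.
by under eq_integral => y _ do rewrite /= normrM (ger0_norm (G0 _)).
Qed.

Lemma average_le_const u (M : R) : measurable_fun [set: X] u ->
  0 <= M -> (forall x, `|u x| <= M) -> (average u <= M%:E)%E.
Proof.
move=> meas_u M0 uM.
apply: (@le_trans _ _ (\int[mu]_x (M%:E * (G x)%:E))%E).
  apply: ge0_le_integral => //; first exact: measurable_Gu.
    by apply/measurable_EFinP; exact: measurable_funM.
  by move=> y _; rewrite lee_fin mulrC ler_wpM2r.
rewrite ge0_integralZl//.
- by rewrite G1 mule1.
- exact/measurable_EFinP.
- by move=> y _; rewrite lee_fin.
Qed.

Lemma average_le_sum u v w (z : X -> R) :
  measurable_fun [set: X] u -> measurable_fun [set: X] v ->
  measurable_fun [set: X] w -> measurable_fun [set: X] z ->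
  (forall x, `|u x| <= `|v x| + `|w x| + `|z x|) ->
  (average u <= average v + average w + average z)%E.
Proof.
move=> meas_u mv mw mz uvwz.
rewrite /average -ge0_integralD//; [|exact: measurable_Gu..].
rewrite -ge0_integralD//; last 3 first.
- by move=> y _; exact: adde_ge0.
- by apply: emeasurable_funD; exact: measurable_Gu.
- exact: measurable_Gu.
apply: ge0_le_integral => //; first exact: measurable_Gu.
  by do ![apply: emeasurable_funD]; exact: measurable_Gu.
move=> y _; rewrite -!EFinD lee_fin -!mulrDr.
by rewrite ler_wpM2l.
Qed.

(** The integral form of [young_linear_bound]: the constant term is paid by the
   total mass of [G], the term in [Phi] by the modular and the bound [G <= y]. *)
Lemma average_le_of_lt Phi u (c k y : R) : young Phi ->
  measurable_fun [set: X] u -> 0 < k -> 0 < c -> 0 < y ->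
  (forall x, G x <= y) ->
  (\int[mu]_x Phi (`|u x| / k)%:E <= 1)%E ->
  (y%:E < Phi c%:E)%E ->
  (average u <= (2 * k * c)%:E)%E.
Proof.
move=> PhiY meas_u k0 c0 y0 Gy modk yc.
have k0' := ltW k0; have c0' := ltW c0.
have kc0 : (0 <= (k * c)%:E)%E by rewrite lee_fin mulr_ge0.
have mPhi : measurable_fun [set: X] (fun x => Phi (`|u x| / k)%:E).
  rewrite (_ : (fun _ => _) = (fun s => Phi `|s|%:E) \o (fun x => u x / k)).
    apply: measurableT_comp; first exact: measurable_young.
    exact: measurable_funM.
  by apply/funext => z /=; rewrite normrM (ger0_norm (x := k^-1))// invr_ge0.
have Phi0 x : (0 <= Phi (`|u x| / k)%:E)%E.
  by rewrite young_ge0// divr_ge0.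
have -> : (2 * k * c)%:E = ((k * c)%:E * 1 + (k * c)%:E * 1)%E.
  by rewrite !mule1 -EFinD; congr EFin; ring.
apply: (@le_trans _ _ (\int[mu]_x
    ((k * c)%:E * (G x)%:E + (k * c)%:E * Phi (`|u x| / k)%:E))%E).
  apply: ge0_le_integral => //.
  - exact: measurable_Gu.
  - apply: emeasurable_funD; apply: measurable_funeM => //.
    exact/measurable_EFinP.
  - move=> x _; have uk0 : 0 <= `|u x| / k by rewrite divr_ge0.
    have := young_linear_bound PhiY c0 y0 yc uk0.
    have Gk0 : (0 <= (G x * k)%:E)%E by rewrite lee_fin mulr_ge0.
    move=> /(lee_wpmul2l Gk0).
    rewrite -EFinM [X in (X%:E <= _)%E](_ : _ = G x * `|u x|); last first.
      by field; rewrite gt_eqF.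
    move=> /le_trans; apply.
    rewrite ge0_muleDr ?lee_fin//; last first.
      by rewrite mule_ge0// lee_fin divr_ge0// ltW.
    apply: leeD; first by rewrite -!EFinM -mulrA mulrC lexx.
    rewrite muleA -EFinM; apply: lee_wpmul2r => //.
    rewrite lee_fin [leLHS](_ : _ = k * c * (G x / y)); last by field; rewrite gt_eqF.
    by rewrite ler_piMr// ?ler_pdivrMr ?mul1r// mulr_ge0.
rewrite ge0_integralD//.
- rewrite !ge0_integralZl//.
  + by rewrite G1 leeD2l// lee_wpmul2l.
  + exact/measurable_EFinP.
  + by move=> x _; rewrite lee_fin.
- by move=> x _; rewrite mule_ge0// lee_fin.
- by apply: measurable_funeM; exact/measurable_EFinP.
- by move=> x _; rewrite mule_ge0.
- exact: measurable_funeM.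
Qed.

Lemma average_le_young_inv Phi u (k y : R) : young Phi ->
  measurable_fun [set: X] u -> 0 < k -> 0 < y ->
  (forall x, G x <= y) ->
  (\int[mu]_x Phi (`|u x| / k)%:E <= 1)%E ->
  (average u <= (2 * k)%:E * young_inv Phi y%:E)%E.
Proof.
move=> PhiY meas_u k0 y0 Gy modk.
rewrite -lee_pdivrMl ?mulr_gt0//; apply/ereal_infP => -[c| |]//=.
- rewrite lte_fin => -[c0 yc]; rewrite lee_pdivrMl ?mulr_gt0// -EFinM.
  exact: (average_le_of_lt PhiY meas_u k0 c0 y0 Gy modk yc).
- by move=> _; rewrite leey.
- by case.
Qed.

End averages.

(** * Heat semigroup on Orlicz spaces *)

Section heat_bounds.
Context {R : realType} (n : nat).
Implicit Types (Phi : \bar R -> \bar R) (u : Rn R n -> R) (t : R).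

Definition heat_kernel t (x y : Rn R n) : R :=
  gauss_kernel ((x : 'rV[R]_n) - (y : 'rV[R]_n)) t.

Definition heat_abs t u (x : Rn R n) : \bar R :=
  average (@lebesgue_Rn R n) (heat_kernel t x) u.

Lemma measurable_heat_kernel t x : measurable_fun [set: Rn R n] (heat_kernel t x).
Proof.
exact: (measurableT_comp (measurable_gauss_kernel (x : 'rV[R]_n) t)
  (@measurable_Rn_rV R n)).
Qed.

Lemma heat_kernel_ge0 t x y : 0 <= heat_kernel t x y.
Proof. exact: gauss_kernel_ge0. Qed.

Lemma abs_heat_le t u x : measurable_fun [set: Rn R n] u ->
  (`|heat t u x| <= heat_abs t u x)%E.
Proof.
move=> mu; exact: (abs_integral_le_average (@lebesgue_Rn R n)
  (measurable_heat_kernel t x) (heat_kernel_ge0 t x) mu).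
Qed.

Lemma Lnorm_oo_le d (X : measurableType d) (mu : {measure set X -> \bar R})
    (f : X -> \bar R) (M : \bar R) : (0 <= M)%E ->
  (forall x, `|f x| <= M)%E -> ('N[mu]_+oo[f] <= M)%E.
Proof.
move=> M0 fM; rewrite unlock; case: ifP => // _.
by apply/ess_supP; exact: aeW.
Qed.

Lemma heat_abs_le_young_inv Phi t u (x : Rn R n) (k : R) : young Phi ->
  measurable_fun [set: Rn R n] u -> 0 < t -> 0 < k ->
  (modular Phi u k <= 1)%E ->
  (heat_abs t u x <=
   (2 * k)%:E * young_inv Phi (t `^ (- (n%:R / 2)))%:E)%E.
Proof.
move=> PhiY mu t0 k0 modk.
exact: (average_le_young_inv (measurable_heat_kernel t x) (heat_kernel_ge0 t x)
  (integral_gauss_kernel (x : 'rV[R]_n) t0) PhiY mu k0 (powR_gt0 _ t0)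
  (fun y => gauss_kernel_le ((x : 'rV[R]_n) - (y : 'rV[R]_n)) t0) modk).
Qed.

(** The generalised inverse is at least [B] at any value above [Phi B]; this is
   finite, so [t^(-n/2)] exceeds it for small [t]. *)
Lemma young_inv_cvgy Phi (B : R) : (0 < n)%N -> young Phi -> young_finite Phi ->
  0 <= B -> \forall t \near 0^'+,
    (B%:E <= young_inv Phi (t `^ (- (n%:R / 2)))%:E)%E.
Proof.
move=> n0 PhiY [[Phifin _ _] _] B0.
have n2 : 0 < n%:R / 2 :> R by rewrite divr_gt0 ?ltr0n.
pose Y := fine (Phi B%:E).
have YE : Phi B%:E = Y%:E by rewrite fineK// Phifin// inE/= in_itv/= B0.
have Y1 : 0 < `|Y| + 1 by rewrite ltr_wpDl.
near=> t; have t0 : 0 < t by [].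
apply: young_inv_ge => //; rewrite YE lee_fin powRN.
rewrite (le_trans (ler_norm _))// (@le_trans _ _ (`|Y| + 1)) ?lerDl//.
rewrite -[leLHS]invrK lef_pV2 ?posrE ?invr_gt0 ?powR_gt0//.
near: t.
have /cvgr0_norm_le/(_ (`|Y| + 1)^-1) := powR_cvg0 n2.
rewrite invr_gt0 => /(_ Y1); apply: filterS => t.
exact: le_trans (ler_norm _).
Unshelve. all: by end_near. Qed.

(** Taking the infimum over admissible [k] needs the generalised inverse to be
   positive and finite, so that one can divide by it. *)
Lemma heat_norm_le Phi (phi : orlicz n Phi) t : young Phi -> 0 < t ->
  ('N[@lebesgue_Rn R n]_+oo[heat t phi] <=
   2%:E * young_inv Phi (t `^ (- (n%:R / 2)))%:E * luxemburg Phi phi)%E.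
Proof.
move=> PhiY t0; set y := t `^ _.
have [bfin b0] := young_inv_fin_num_gt0 PhiY (powR_gt0 (- (n%:R / 2)) t0).
rewrite -/y in bfin b0; move: bfin b0 (@heat_abs_le_young_inv Phi t).
rewrite -/y; case: (young_inv Phi y%:E) => [b| |]// _.
rewrite lte_fin => b0 bound; rewrite -EFinM.
have b2 : 0 < 2 * b by rewrite mulr_gt0.
apply: Lnorm_oo_le => [|x].
  apply: mule_ge0; first by rewrite lee_fin ltW.
  apply/ereal_infP => _ [k [k0 _] <-].
  by rewrite lee_fin ltW.
apply: (le_trans (abs_heat_le _ _ (orlicz_measurable phi))).
rewrite -lee_pdivrMl//; apply/ereal_infP => _ [k [k0 modk] <-].
rewrite lee_pdivrMl// -EFinM (le_trans (bound _ x k _ (orlicz_measurable phi) _ _ _))//.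
by rewrite -EFinM lee_fin mulrAC.
Qed.

Lemma test_function_bounded (f : 'rV[R]_n -> R) : test_function f ->
  exists2 M, 0 <= M & forall x, `|f x| <= M.
Proof.
move=> [/(_ 0%N)/= fc cf].
have [M [_ fM]] := compact_bounded (continuous_compact (continuous_subspaceT fc) cf).
exists (`|M| + 1) => [|x]; first by rewrite addr_ge0.
have [->|fx0] := eqVneq (f x) 0; first by rewrite normr0 addr_ge0.
apply: fM; first by rewrite ltr_pwDr// ler_norm.
by exists x => //; exact: subset_closure.
Qed.

(** Balls form a subbase by definition of the topology. *)
Lemma open_orlicz_ball Phi (u : orlicz n Phi) (r : R) : 0 < r ->
  open (orlicz_ball u r).
Proof.
move=> r0.
exists [set orlicz_ball u r]; last by rewrite bigcup_set1.
move=> _ ->; exists (finmap.fset1 (orlicz_ball u r)).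
  by move=> B; rewrite finmap.in_fset1 => /eqP ->; rewrite inE; exists u, r.
by rewrite set_fset1 bigcap_set1.
Qed.

Lemma orlicz_ball_center Phi (u : orlicz n Phi) (r : R) : young Phi -> 0 < r ->
  orlicz_ball u r u.
Proof.
move=> [_ Phi0 _] r0; rewrite /orlicz_ball/=.
apply/ereal_inf_ltP; exists (r / 2)%:E; last by rewrite lte_fin; lra.
exists (r / 2) => //; split; first by rewrite divr_gt0.
rewrite /modular; under eq_integral do rewrite subrr normr0 mul0r Phi0.
by rewrite integral0.
Qed.

Lemma orlicz_ball_heat_abs Phi (u v : orlicz n Phi) t (r : R) x : young Phi -> 0 < t ->
  orlicz_ball u r v ->
  (heat_abs t (fun y => (u y - v y)%R) x <=
   (2 * r)%:E * young_inv Phi (t `^ (- (n%:R / 2)))%:E)%E.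
Proof.
move=> PhiY t0 /ereal_inf_ltP[_ [k [k0 modk] <-]]; rewrite lte_fin => kr.
have muv : measurable_fun [set: Rn R n] (fun y => u y - v y).
  apply: measurable_funB; exact: orlicz_measurable.
apply: (le_trans (heat_abs_le_young_inv x PhiY muv t0 k0 modk)).
have [_ b0] := young_inv_fin_num_gt0 PhiY (powR_gt0 (- (n%:R / 2)) t0).
by apply: lee_wpmul2r; [exact: ltW | rewrite lee_fin ler_pM2l// ltW].
Qed.

(** The estimate is proved near each [chi] of [K], jointly in [phi] and [t];
   compactness of [K] then gives a common range of [t]. *)
Lemma heat_norm_small_near0 Phi (K : set (orlicz n Phi)) (eps : R) : (0 < n)%N ->
  young Phi -> young_finite Phi -> compact K -> K `<=` @orlicz0 R n Phi ->
  0 < eps -> \forall t \near 0^'+, forall phi : orlicz n Phi, K phi ->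
        ('N[@lebesgue_Rn R n]_+oo[heat t phi] /
         young_inv Phi (t `^ (- (n%:R / 2)))%:E < eps%:E)%E.
Proof.
move=> n0 PhiY Phif cK K0 e0.
(* the two small terms contribute [4 * d = eps / 4], the bounded one [eps / 4] *)
pose d := eps / 16.
have d0 : 0 < d by rewrite divr_gt0.
have /compact_near_coveringP nK := cK.
apply: (nK _ (0^'+) (fun t phi => ('N[@lebesgue_Rn R n]_+oo[heat t phi] /
  young_inv Phi (t `^ (- (n%:R / 2)))%:E < eps%:E)%E)) => chi Kchi.
have nchi : nbhs chi (orlicz_ball chi d).
  apply: open_nbhs_nbhs; split; first exact: open_orlicz_ball.
  exact: orlicz_ball_center.
have [psi [tpsi chipsi]] := K0 _ Kchi _ nchi.
have [S S0 psiS] := test_function_bounded tpsi.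
near=> phi t; have t0 : 0 < t by near: t; exact: nbhs_right_gt.
have phichi : orlicz_ball chi d phi by near: phi.
have : ((4 * S / eps)%:E <= young_inv Phi (t `^ (- (n%:R / 2)))%:E)%E.
  near: t; apply: young_inv_cvgy => //.
  by rewrite divr_ge0 ?mulr_ge0// ltW.
have [bfin b0] := young_inv_fin_num_gt0 PhiY (powR_gt0 (- (n%:R / 2)) t0).
have mo (u : orlicz n Phi) := orlicz_measurable u.
have bound x : (heat_abs t phi x <=
   (2 * d)%:E * young_inv Phi (t `^ (- (n%:R / 2)))%:E +
   (2 * d)%:E * young_inv Phi (t `^ (- (n%:R / 2)))%:E + S%:E)%E.
  have split_phi y : `|phi y| <= `|chi y - phi y| + `|chi y - psi y| + `|psi y|.
    have := ler_normB (chi y - psi y) (chi y - phi y).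
    have := ler_normD (chi y - psi y - (chi y - phi y)) (psi y).
    rewrite (_ : _ - _ + _ = phi y); last by ring.
    lra.
  have mB (u v : orlicz n Phi) : measurable_fun [set: Rn R n] (fun y => u y - v y).
    by apply: measurable_funB; exact: mo.
  apply: (le_trans (average_le_sum (@lebesgue_Rn R n)
    (measurable_heat_kernel t x) (heat_kernel_ge0 t x) (mo phi) (mB chi phi)
    (mB chi psi) (mo psi) split_phi)).
  apply: leeD; first by apply: leeD; exact: orlicz_ball_heat_abs.
  exact: (average_le_const (measurable_heat_kernel t x) (heat_kernel_ge0 t x)
    (integral_gauss_kernel (x : 'rV[R]_n) t0) (mo psi) S0 psiS).
move: bfin b0 bound; case: (young_inv _ _) => [b| |]// _.
rewrite lte_fin => b0 bound; rewrite lee_fin => bS.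
rewrite inver gt_eqF// lte_pdivrMr//.
apply: (@le_lt_trans _ _ (4 * d * b + S)%:E).
  apply: Lnorm_oo_le => [|x].
    by rewrite lee_fin addr_ge0// !mulr_ge0// ltW.
  rewrite (le_trans (abs_heat_le t x (mo phi)))// (le_trans (bound x))//.
  by rewrite -!EFinM -!EFinD lee_fin /d; lra.
rewrite -EFinM lte_fin.
move: bS; rewrite ler_pdivrMr// /d => bS.
have eb : 0 < eps * b by rewrite mulr_gt0.
rewrite (_ : 4 * (eps / 16) * b = eps * b / 4); last by field.
rewrite mulrC in bS *; lra.
Unshelve. all: by end_near. Qed.

End heat_bounds.

Theorem corollaryA (R : realType) (n : nat) (n_gt0 : (0 < n)%N)
    (Phi : \bar R -> \bar R) (Phi_young : young Phi) :
  (exists C : R, 0 < C /\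
    forall (phi : orlicz n Phi) (t : R), 0 < t ->
      ('N[@lebesgue_Rn R n]_+oo[heat t phi] <=
       C%:E * young_inv Phi (t `^ (- (n%:R / 2)))%:E * luxemburg Phi phi)%E)
  /\
  (young_finite Phi ->
    forall K : set (orlicz n Phi), compact K -> K `<=` @orlicz0 R n Phi ->
    forall eps : R, 0 < eps ->
      \forall t \near 0^'+, forall phi : orlicz n Phi, K phi ->
        ('N[@lebesgue_Rn R n]_+oo[heat t phi] /
         young_inv Phi (t `^ (- (n%:R / 2)))%:E < eps%:E)%E).
Proof.
split; first by exists 2; split=> // phi t t0; exact: heat_norm_le.
by move=> Phif K cK K0 eps e0; exact: heat_norm_small_near0.
Qed.
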